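(* For any integer $n\ge1$, the following assertions hold: (1) every monic irreducible factor of $S_n$ or of $C_n$ is monogenic; (2) if $x\in\mathbb{C}$ is a root of $U_n$ or of $T_n$, then $\mathcal{O}_{\mathbb{Q}(x)}=\mathbb{Z}[2x]$.
   Context: $\mathcal{O}_K$ denotes the ring of integers of a number field $K$. A monic irreducible polynomial $f\in\mathbb{Z}[X]$ is called monogenic if it has a root $\alpha$ with $\mathbb{Z}[\alpha]=\mathcal{O}_{\mathbb{Q}(\alpha)}$. The Chebyshev polynomials of the first and second kind are defined by $T_0=1$, $T_1=X$, $T_{n+2}=2X\,T_{n+1}-T_n$ and $U_0=1$, $U_1=2X$, $U_{n+2}=2X\,U_{n+1}-U_n$. The polynomials $C_n,S_n\in\mathbb{Z}[X]$ are the Dickson polynomials of the first and second kind with parameter $1$: $C_0=2$, $C_1=X$, $C_{n+2}=X\,C_{n+1}-C_n$, and $S_0=1$, $S_1=X$, $S_{n+2}=X\,S_{n+1}-S_n$. For $n\ge1$ both $C_n$ and $S_n$ are monic of degree $n$. *)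

(* Defs.v *)
From HB Require Import structures.
From mathcomp Require Import all_boot all_order all_algebra.
From mathcomp Require Import complex.
From mathcomp Require Import boolp classical_sets reals.
Set Implicit Arguments.
Unset Strict Implicit.
Unset Printing Implicit Defensive.
Import Order.TTheory GRing.Theory Num.Theory.
Local Open Scope classical_set_scope.
Local Open Scope ring_scope.

Fixpoint chebyshevT (n : nat) : {poly int} :=
  match n with
  | 0%N => 1
  | 1%N => 'X
  | (k.+1 as m).+1 => 2 *: 'X * chebyshevT m - chebyshevT k
  end.

Fixpoint chebyshevU (n : nat) : {poly int} :=
  match n with
  | 0%N => 1
  | 1%N => 2 *: 'X
  | (k.+1 as m).+1 => 2 *: 'X * chebyshevU m - chebyshevU k
  end.

Fixpoint dicksonC (n : nat) : {poly int} :=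
  match n with
  | 0%N => 2
  | 1%N => 'X
  | (k.+1 as m).+1 => 'X * dicksonC m - dicksonC k
  end.

Fixpoint dicksonS (n : nat) : {poly int} :=
  match n with
  | 0%N => 1
  | 1%N => 'X
  | (k.+1 as m).+1 => 'X * dicksonS m - dicksonS k
  end.

(* [irreducible_poly] and [%|] use pseudo-division: over [int] they describe
   irreducibility and divisibility in Q[X]. The two notions below are those of
   the ring Z[X] itself. *)
Definition irreducible_ZX (f : {poly int}) : Prop :=
  [/\ f != 0, f \isn't a GRing.unit &
      forall g h : {poly int},
        f = g * h -> g \is a GRing.unit \/ h \is a GRing.unit].

Definition divides_ZX (f p : {poly int}) : Prop :=
  exists g : {poly int}, p = f * g.

Section Subrings.
Variable F : numFieldType.
Implicit Types (x y : F) (K : set F).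

Definition Zadjoin x : set F :=
  [set y | exists p : {poly int}, y = (map_poly intr p).[x]].

Definition Qadjoin x : set F :=
  [set y | exists p q : {poly rat},
     (map_poly ratr q).[x] != 0 /\
     y = (map_poly ratr p).[x] / (map_poly ratr q).[x]].

Definition ring_of_integers K : set F :=
  [set y | K y /\ integralOver (intr : int -> F) y].

End Subrings.

Definition monogenic (R : realType) (f : {poly int}) : Prop :=
  [/\ f \is monic, irreducible_ZX f &
      exists2 alpha : R[i], root (map_poly intr f) alpha &
        Zadjoin alpha = ring_of_integers (Qadjoin alpha)].

(* Main.v *)
Require Import Defs.
From HB Require Import structures.
From mathcomp Require Import all_boot all_order all_algebra.
From mathcomp Require Import cyclic cyclotomic ring.
From mathcomp Require Import complex.
From mathcomp Require Import boolp classical_sets reals.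
Set Implicit Arguments.
Unset Strict Implicit.
Unset Printing Implicit Defensive.
Import Order.TTheory GRing.Theory Num.Theory.
Local Open Scope classical_set_scope.
Local Open Scope ring_scope.

(** A root of S_n or C_n has the form z + 1/z with z a root of unity. Call d in
    A = Z[z] saturated if every b in A with b/d integral lies in dA; products of
    saturated elements are saturated. If d divides both a prime p and z^m - 1 in
    A with p not dividing m, then d is saturated, because A/dA is reduced: some
    power b -> b^(p^f) is the identity on it. If z has order m p^k and w = z^m,
    then for k > 0 the prime p = Phi_(p^k)(1) is the product of such d, namely of
    the 1 - w^i with i prime to p. So all nonzero integers are saturated, and
    every integral element of Q(z) lies in A. Finally A = B + B z for
    B = Z[z + 1/z], and complex conjugation fixes Q(z + 1/z) pointwise, so an
    integral element of that field has no z-component. *)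

(** * The ring Z[z], divisibility in it, and saturated elements *)

Section Zadjoin.
Variables (F : numFieldType) (z : F).
Implicit Types (a b d x y : F).

Lemma Zadjoin_int (c : int) : Zadjoin z c%:~R.
Proof. by exists c%:P; rewrite map_polyC hornerC. Qed.

Lemma Zadjoin_nat (k : nat) : Zadjoin z k%:R.
Proof. by have := Zadjoin_int k%:Z; rewrite -pmulrn. Qed.

Lemma Zadjoin0 : Zadjoin z 0. Proof. exact: (Zadjoin_nat 0). Qed.

Lemma Zadjoin1 : Zadjoin z 1. Proof. exact: (Zadjoin_nat 1). Qed.

Lemma Zadjoin_gen : Zadjoin z z.
Proof. by exists 'X; rewrite map_polyX hornerX. Qed.

Lemma ZadjoinD x y : Zadjoin z x -> Zadjoin z y -> Zadjoin z (x + y).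
Proof. by move=> [p ->] [q ->]; exists (p + q); rewrite rmorphD hornerD. Qed.

Lemma ZadjoinM x y : Zadjoin z x -> Zadjoin z y -> Zadjoin z (x * y).
Proof. by move=> [p ->] [q ->]; exists (p * q); rewrite rmorphM hornerM. Qed.

Lemma ZadjoinN x : Zadjoin z x -> Zadjoin z (- x).
Proof. by move=> [p ->]; exists (- p); rewrite rmorphN hornerN. Qed.

Lemma ZadjoinB x y : Zadjoin z x -> Zadjoin z y -> Zadjoin z (x - y).
Proof. by move=> zx zy; apply: ZadjoinD => //; apply: ZadjoinN. Qed.

Lemma ZadjoinX x k : Zadjoin z x -> Zadjoin z (x ^+ k).
Proof.
move=> zx; elim: k => [|k IH]; first exact: Zadjoin1.
by rewrite exprS; apply: ZadjoinM.
Qed.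

Lemma Zadjoin_sum I (r : seq I) (P : pred I) (f : I -> F) :
  (forall i, P i -> Zadjoin z (f i)) -> Zadjoin z (\sum_(i <- r | P i) f i).
Proof. by move=> zf; apply: big_ind => //; [exact: Zadjoin0|exact: ZadjoinD]. Qed.

Lemma Zadjoin_horner (p : {poly int}) x :
  Zadjoin z x -> Zadjoin z (map_poly intr p).[x].
Proof.
move=> zx; elim/poly_ind: p => [|p c IH].
  by rewrite rmorph0 horner0; exact: Zadjoin0.
rewrite rmorphD rmorphM /= map_polyX map_polyC hornerMXaddC.
by apply: ZadjoinD; [apply: ZadjoinM|apply: Zadjoin_int].
Qed.

Lemma Zadjoin_integral x :
  integralOver (intr : int -> F) z -> Zadjoin z x ->
  integralOver (intr : int -> F) x.
Proof.
move=> iz [p ->]; apply: (integral_horner (RtoK := intr)) => //.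
by apply/integral_poly => i; rewrite coef_map; apply: integral_id.
Qed.

Definition Zdvd d x : Prop := exists2 c, Zadjoin z c & x = d * c.

Lemma Zdvd0 d : Zdvd d 0.
Proof. by exists 0; rewrite ?mulr0//; apply: Zadjoin0. Qed.

Lemma ZdvdD d x y : Zdvd d x -> Zdvd d y -> Zdvd d (x + y).
Proof.
by move=> [a za ->] [b zb ->]; exists (a + b); rewrite ?mulrDr//; apply: ZadjoinD.
Qed.

Lemma ZdvdN d x : Zdvd d x -> Zdvd d (- x).
Proof. by move=> [a za ->]; exists (- a); rewrite ?mulrN//; apply: ZadjoinN. Qed.

Lemma ZdvdB d x y : Zdvd d x -> Zdvd d y -> Zdvd d (x - y).
Proof. by move=> dx dy; apply: ZdvdD => //; apply: ZdvdN. Qed.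

Lemma Zdvd_mulr d x a : Zadjoin z a -> Zdvd d x -> Zdvd d (x * a).
Proof.
by move=> za [c zc ->]; exists (c * a); rewrite ?mulrA//; apply: ZadjoinM.
Qed.

Lemma Zdvd_trans d x y : Zdvd d x -> Zdvd x y -> Zdvd d y.
Proof. by move=> dx [c zc ->]; apply: Zdvd_mulr. Qed.

Lemma Zdvd_subrXX d x y k : Zadjoin z x -> Zadjoin z y ->
  Zdvd d (x - y) -> Zdvd d (x ^+ k - y ^+ k).
Proof.
move=> zx zy dxy; rewrite subrXX; apply: Zdvd_mulr => //.
by apply: Zadjoin_sum => i _; apply: ZadjoinM; apply: ZadjoinX.
Qed.

(** For exponent [p] the inner binomial coefficients are multiples of [p]; congruences modulo [p]
    survive [p]-th powers, which carries the induction on [k]. *)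
Lemma Zdvd_exprDp p k x y : prime p -> Zadjoin z x -> Zadjoin z y ->
  Zdvd p%:R ((x + y) ^+ (p ^ k) - (x ^+ (p ^ k) + y ^+ (p ^ k))).
Proof.
move=> p_pr; elim: k x y => [|k IH] x y zx zy.
  by rewrite expn0 !expr1 subrr; apply: Zdvd0.
have step a b : Zadjoin z a -> Zadjoin z b ->
    Zdvd p%:R ((a + b) ^+ p - (a ^+ p + b ^+ p)).
  move=> za zb; case: p p_pr {IH} => [|q] // p_pr.
  rewrite exprDn big_ord_recl big_ord_recr /=.
  rewrite subn0 expr0 mulr1 bin0 mulr1n subnn expr0 mul1r binn mulr1n.
  set S := \sum_(i < _) _.
  have -> : a ^+ q.+1 + (S + b ^+ q.+1) - (a ^+ q.+1 + b ^+ q.+1) = S by ring.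
  apply: big_ind => [||i _]; [exact: Zdvd0|exact: ZdvdD|].
  have /dvdnP[c ->] : (q.+1 %| 'C(q.+1, bump 0 i))%N.
    by apply: prime_dvd_bin => //; rewrite /bump /= add1n ltnS ltn_ord.
  rewrite -[X in Zdvd _ X]mulr_natr natrM mulrA; exists (a ^+ (q.+1 - bump 0 i) * b ^+ bump 0 i * c%:R).
    apply: ZadjoinM; last exact: Zadjoin_nat.
    by apply: ZadjoinM; apply: ZadjoinX.
  by rewrite mulrC.
rewrite expnS mulnC !exprM.
set u := (x + y) ^+ _; set v := x ^+ _; set w := y ^+ _.
have [zu zv zw] : [/\ Zadjoin z u, Zadjoin z v & Zadjoin z w].
  by split; apply: ZadjoinX => //; apply: ZadjoinD.
have -> : u ^+ p - (v ^+ p + w ^+ p) =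
  (u ^+ p - (v + w) ^+ p) + ((v + w) ^+ p - (v ^+ p + w ^+ p)) by ring.
apply: ZdvdD; last exact: step.
by apply: Zdvd_subrXX; rewrite //; [apply: ZadjoinD|apply: IH].
Qed.

Definition saturated d : Prop := forall b,
  Zadjoin z b -> integralOver (intr : int -> F) (b / d) -> Zdvd d b.

Lemma saturated1 : saturated 1.
Proof. by move=> b zb _; exists b; rewrite ?mul1r. Qed.

(** Since [b / d] equals [b / (d * e) * e], it is integral as well; so [d] can be cancelled first
    and [e] afterwards. *)
Lemma saturatedM d e : d != 0 -> e != 0 ->
  integralOver (intr : int -> F) e ->
  saturated d -> saturated e -> saturated (d * e).
Proof.
move=> d0 e0 ie sd se b zb ib.
have [|c zc bE] := sd b zb.
  have -> : b / d = b / (d * e) * e by field; rewrite d0 e0.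
  exact: (integral_mul (RtoK := intr)).
have [|c' zc' cE] := se c zc.
  by have <- : b / (d * e) = c / e by rewrite bE; field; rewrite d0 e0.
by exists c'; rewrite // bE cE mulrA.
Qed.

(** In a monic equation of degree [k] for [b / d], multiplied by [d ^+ k], every term except
    [b ^+ k] keeps a factor [d]. *)
Lemma Zdvd_expr_of_integral d b : d != 0 -> Zadjoin z d -> Zadjoin z b ->
  integralOver (intr : int -> F) (b / d) ->
  exists k, Zdvd d (b ^+ k).
Proof.
move=> d0 zd zb [r r_mon /rootP r0].
have szr : (size (map_poly intr r : {poly F}) = (size r).-1.+1)%N.
  rewrite size_map_poly_id0 ?(monicP r_mon) ?oner_eq0// prednK// size_poly_gt0.
  exact: monic_neq0.
move: r0; rewrite horner_coef szr big_ord_recr /= coef_map /=.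
rewrite -[r`__]/(lead_coef r) (monicP r_mon) mul1r => /eqP.
set k := (size r).-1; rewrite addrC addr_eq0 => /eqP bk.
exists k.
have -> : b ^+ k = d ^+ k * (b / d) ^+ k by rewrite exprMn exprVn; field; rewrite expf_neq0.
rewrite bk mulrN mulr_sumr; apply: ZdvdN.
apply: big_ind => [||i _]; [exact: Zdvd0|exact: ZdvdD|].
exists (d ^+ (k - i).-1 * ((r`_i)%:~R * b ^+ i)).
  apply: ZadjoinM; first exact: ZadjoinX.
  by apply: ZadjoinM; [exact: Zadjoin_int|exact: ZadjoinX].
have -> : d ^+ k = d * d ^+ (k - i).-1 * d ^+ i.
  by rewrite -exprS prednK ?subn_gt0// -exprD subnK// ltnW.
by rewrite coef_map /= exprMn exprVn; field; rewrite expf_neq0.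
Qed.

(* Modulo [d] the iterated Frobenius fixes [z], hence all of Z[z], so that
   Z[z]/(d) is reduced. *)
Lemma Frobenius_saturated d p m : prime p -> coprime p m -> (0 < m)%N ->
  d != 0 -> Zadjoin z d -> Zdvd d p%:R -> Zdvd d (z ^+ m - 1) -> saturated d.
Proof.
move=> p_pr cop m0 d0 zd dp dz b zb ib.
(* Chosen so that [P] is 1 modulo [m] by Euler's theorem; as [z ^+ m] is 1 modulo [d], raising to
   the power [P] then fixes [z] modulo [d]. *)
set P := (p ^ totient m)%N.
have P2 : (1 < P)%N by rewrite -(exp1n (totient m)) ltn_exp2r ?prime_gt1 ?totient_gt0.
have fD x y : Zadjoin z x -> Zadjoin z y -> Zdvd d ((x + y) ^+ P - (x ^+ P + y ^+ P)).
  by move=> zx zy; apply: Zdvd_trans dp _; apply: Zdvd_exprDp.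
have fixD x y : Zadjoin z x -> Zadjoin z y ->
    Zdvd d (x ^+ P - x) -> Zdvd d (y ^+ P - y) -> Zdvd d ((x + y) ^+ P - (x + y)).
  move=> zx zy dx dy.
  have -> : (x + y) ^+ P - (x + y) =
    (x + y) ^+ P - (x ^+ P + y ^+ P) + ((x ^+ P - x) + (y ^+ P - y)) by ring.
  by apply: ZdvdD; [apply: fD|apply: ZdvdD].
(* Additivity applied to [x + (- x)] gives the sign without a case distinction on the parity of
   [P]. *)
have fixN x : Zadjoin z x -> Zdvd d (x ^+ P - x) -> Zdvd d ((- x) ^+ P - (- x)).
  move=> zx dx.
  have -> : (- x) ^+ P - (- x) =
    - ((x - x) ^+ P - (x ^+ P + (- x) ^+ P)) - (x ^+ P - x).
    by rewrite subrr expr0n gtn_eqF ?(ltnW P2) //=; ring.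
  by apply: ZdvdB => //; apply: ZdvdN; apply: fD => //; apply: ZadjoinN.
have fix_nat k : Zdvd d (k%:R ^+ P - k%:R).
  elim: k => [|k IH]; first by rewrite expr0n gtn_eqF ?(ltnW P2) //= subrr; apply: Zdvd0.
  rewrite -natr1; apply: fixD => //; [exact: Zadjoin_nat|exact: Zadjoin1|].
  by rewrite expr1n subrr; apply: Zdvd0.
have fix_int (c : int) : Zdvd d (c%:~R ^+ P - c%:~R).
  by case: c => k; rewrite ?NegzE ?mulrNz -pmulrn //; apply: fixN => //; exact: Zadjoin_nat.
have fix_gen : Zdvd d (z ^+ P - z).
  have /eqP := Euler_exp_totient cop; rewrite -/P eqn_mod_dvd ?(ltnW P2)// => /dvdnP[t Pt].
  have -> : z ^+ P - z = ((z ^+ m) ^+ t - 1 ^+ t) * z.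
    by rewrite -exprM mulnC -Pt expr1n mulrBl mul1r -exprSr subn1 prednK// ltnW.
  apply: Zdvd_mulr; first exact: Zadjoin_gen.
  by apply: Zdvd_subrXX => //; [apply: ZadjoinX; apply: Zadjoin_gen|apply: Zadjoin1].
have fixA x : Zadjoin z x -> Zdvd d (x ^+ P - x).
  move=> [q ->]; elim/poly_ind: q => [|q c IH].
    by rewrite rmorph0 horner0 expr0n gtn_eqF ?(ltnW P2) //= subrr; apply: Zdvd0.
  rewrite rmorphD rmorphM /= map_polyX map_polyC hornerMXaddC.
  have zq : Zadjoin z (map_poly intr q).[z] by exists q.
  apply: fixD => //; [by apply: ZadjoinM => //; apply: Zadjoin_gen|exact: Zadjoin_int| |exact: fix_int].
  set y := _.[z] in zq IH *.
  have -> : (y * z) ^+ P - y * z = (y ^+ P - y) * z ^+ P + (z ^+ P - z) * y by rewrite exprMn; ring.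
  by apply: ZdvdD; apply: Zdvd_mulr => //; apply: ZadjoinX; apply: Zadjoin_gen.
have [k dbk] := Zdvd_expr_of_integral d0 zd zb ib.
have fix_iter j : Zdvd d (b ^+ (P ^ j) - b).
  elim: j => [|j IH]; first by rewrite expn0 expr1 subrr; apply: Zdvd0.
  rewrite expnS mulnC exprM.
  have -> : (b ^+ (P ^ j)) ^+ P - b =
     ((b ^+ (P ^ j)) ^+ P - b ^+ (P ^ j)) + (b ^+ (P ^ j) - b) by ring.
  by apply: ZdvdD => //; apply: fixA; apply: ZadjoinX.
(* Because [k < P ^ k], the power [b ^+ (P ^ k)] is a multiple of [b ^+ k], hence of [d]; and it is
   congruent to [b]. *)
have -> : b = b ^+ k * b ^+ (P ^ k - k) - (b ^+ (P ^ k) - b).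
  by rewrite -exprD subnKC ?(ltnW (ltn_expl _ _))//; ring.
by apply: ZdvdB => //; apply: Zdvd_mulr => //; apply: ZadjoinX.
Qed.

End Zadjoin.

(** With M = p^(k+1) and L = p^k, the product is the M-th cyclotomic polynomial at 1; this
    polynomial is the quotient of X^M - 1 by X^L - 1, a sum of [p] powers of X^L. *)
Lemma prime_prod_prim_root (F : fieldType) (p k : nat) (w : F) : prime p ->
  (p ^ k.+1).-primitive_root w ->
  p%:R = \prod_(i < p ^ k.+1 | coprime i (p ^ k.+1)) (1 - w ^+ i).
Proof.
move=> p_pr w_prim; set M := (p ^ k.+1)%N in w_prim *; set L := (p ^ k)%N.
have p0 := prime_gt0 p_pr.
have ML : M = (p * L)%N by rewrite /M expnS.
have L0 : (0 < L)%N by rewrite expn_gt0 p0.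
have wp_prim : L.-primitive_root (w ^+ p).
  have -> : p = (M %/ L)%N by rewrite ML mulnK.
  by apply: dvdn_prim_root; rewrite // ML dvdn_mull.
(* The divisors of [M] other than [M] are those of [L], so their cyclotomic factors multiply to X^L
   - 1. *)
have divM : perm_eq (divisors M) (M :: divisors L).
  apply: uniq_perm; rewrite ?divisors_uniq //=.
    rewrite divisors_uniq andbT -dvdn_divisors // gtnNdvd // ML.
    by rewrite -[X in (X < _)%N]mul1n ltn_pmul2r // prime_gt1.
  move=> d; rewrite inE -!dvdn_divisors ?expn_gt0 ?p0 //.
  apply/idP/orP => [/(dvdn_pfactor _ _ p_pr) [j]|[/eqP-> //|]].
    rewrite leq_eqVlt => /orP[/eqP-> ->|ljk ->]; first by left.
    by right; rewrite dvdn_exp2l.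
  by move/dvdn_trans; apply; rewrite ML dvdn_mull.
have := prod_cyclotomic w_prim; rewrite (perm_big _ divM) big_cons /=.
have -> : \prod_(d <- divisors L) cyclotomic (w ^+ (M %/ d)) d = 'X^L - 1.
  rewrite (prod_cyclotomic wp_prim) big_seq [RHS]big_seq; apply: eq_bigr => d.
  by rewrite -dvdn_divisors // => dL; rewrite -exprM ML muln_divA.
rewrite divnn expn_gt0 p0 expr1 [X in 'X^X]ML mulnC exprM subrX1 mulrC.
move=> /(mulIf (monic_neq0 (monic_Xn_sub_1 _ L0)))/(congr1 (horner^~ 1)).
rewrite /cyclotomic horner_prod horner_sum => H.
transitivity (\sum_(i < p) ('X^L ^+ i).[1 : F]).
  under eq_bigr do rewrite -exprM hornerXn expr1n.
  by rewrite sumr_const card_ord.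
by rewrite H; apply: eq_bigr => i _; rewrite hornerXsubC.
Qed.

(** * Integral closedness of Z[z] for a root of unity z *)

Section RootOfUnity.
Variables (F : numFieldType) (n : nat) (z : F).
Hypothesis z_prim : n.-primitive_root z.

Lemma prim_root_integral : integralOver (intr : int -> F) z.
Proof.
exists ('X^n - 1); first exact/monic_Xn_sub_1/(prim_order_gt0 z_prim).
by rewrite rmorphB rmorph1 /= map_polyXn rootE hornerD hornerN hornerXn hornerC
  (prim_expr_order z_prim) subrr.
Qed.

Lemma Zadjoin_prim_root_saturated_prime p : prime p -> saturated z p%:R.
Proof.
move=> p_pr; have p0 : p%:R != 0 :> F by rewrite pnatr_eq0 -lt0n prime_gt0.
have [m cop] := pfactor_coprime p_pr (prim_order_gt0 z_prim).
have m0 : (0 < m)%N.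
  by case: m cop => //; rewrite /coprime gcdn0 => /eqP p1; rewrite p1 in p_pr.
(* If [p] does not divide [n], then [m = n] and [p] itself meets the criterion, since [z ^+ m - 1]
   vanishes. *)
case: (logn p n) => [|k] nE.
  apply: (Frobenius_saturated p_pr cop m0 p0); first exact: Zadjoin_nat.
    by exists 1; rewrite ?mulr1 //; apply: Zadjoin1.
  by rewrite -(muln1 m) -(expn0 p) -nE (prim_expr_order z_prim) subrr; apply: Zdvd0.
set M := (p ^ k.+1)%N in nE; set w := z ^+ m.
have M0 : (0 < M)%N by rewrite expn_gt0 prime_gt0.
have M1 : (1 < M)%N by rewrite -(exp1n k.+1) ltn_exp2r ?prime_gt1.
have w_prim : M.-primitive_root w.
  have -> : w = z ^+ (n %/ M) by rewrite nE mulnK.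
  by apply: dvdn_prim_root => //; rewrite nE dvdn_mull.
have zw : Zadjoin z w by apply: ZadjoinX; apply: Zadjoin_gen.
have zw1 i : Zadjoin z (1 - w ^+ i).
  by apply: ZadjoinB; [apply: Zadjoin1|apply: ZadjoinX].
have w1i i : integralOver (intr : int -> F) (1 - w ^+ i).
  by apply: Zadjoin_integral (zw1 i); apply: prim_root_integral.
have pE := prime_prod_prim_root p_pr w_prim.
(* Nonvanishing and integrality are carried along because [saturatedM] asks for them. *)
pose good d := [/\ d != 0, integralOver (intr : int -> F) d & saturated z d].
suff [] : good p%:R by [].
rewrite pE; apply: (big_ind good) => [|d e [d0 di ds] [e0 ei es]|i copi].
- split; [exact: oner_neq0|exact: (integral1 intr)|exact: saturated1].
- split; [by rewrite mulf_neq0| |exact: saturatedM].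
  exact: (integral_mul (RtoK := intr)).
have wi0 : 1 - w ^+ i != 0.
  rewrite subr_eq0 eq_sym -(prim_order_dvd w_prim); apply: contraTN copi.
  by rewrite /coprime => /gcdn_idPr ->; rewrite gtn_eqF.
split=> //; apply: (Frobenius_saturated p_pr cop m0 wi0) => //.
  rewrite pE (bigD1 i) //=.
  exists (\prod_(j < M | coprime j M && (j != i)) (1 - w ^+ j)) => //.
  by apply: big_ind => //; [exact: Zadjoin1|exact: ZadjoinM].
(* By Euler, [i ^ (totient M).-1] inverts [i] modulo [M]; hence [w] is a power of [w ^+ i], and
   [1 - w ^+ i] divides [w - 1]. *)
rewrite -/w; have -> : w - 1 = (w ^+ i) ^+ (i ^ (totient M).-1) - 1 ^+ (i ^ (totient M).-1).
  rewrite -exprM -expnS prednK ?totient_gt0 // expr1n -(prim_expr_mod w_prim).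
  by rewrite Euler_exp_totient // modn_small.
apply: Zdvd_subrXX; [exact: ZadjoinX|exact: Zadjoin1|].
by rewrite -[w ^+ i - 1]opprB; apply: ZdvdN; exists 1; rewrite ?mulr1 //; apply: Zadjoin1.
Qed.

Lemma Zadjoin_prim_root_saturated k : (0 < k)%N -> saturated z k%:R.
Proof.
elim/ltn_ind: k => k IH k0.
have [k1|k1] := leqP k 1.
  have -> : k = 1%N by apply/eqP; rewrite eqn_leq k1.
  exact: saturated1.
have p_pr := pdiv_prime k1; have kE := divnK (pdiv_dvd k).
have q0 : (0 < k %/ pdiv k)%N by rewrite divn_gt0 ?pdiv_leq ?pdiv_gt0.
rewrite -kE natrM; apply: saturatedM.
- by rewrite pnatr_eq0 -lt0n.
- by rewrite pnatr_eq0 -lt0n pdiv_gt0.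
- exact: (integral_nat intr).
- by apply: IH; rewrite // ltn_Pdiv // prime_gt1.
- exact: Zadjoin_prim_root_saturated_prime.
Qed.

(** Up to sign the denominator [c] is a positive integer, hence saturated, and can be cancelled. *)
Lemma Zadjoin_prim_root_integrally_closed (c : int) a : c != 0 ->
  Zadjoin z (c%:~R * a) -> integralOver (intr : int -> F) a -> Zadjoin z a.
Proof.
move=> c0 zca ia.
have z_abs : Zadjoin z (`|c|%N%:R * a).
  case: c c0 zca => k _; first by rewrite -pmulrn.
  by rewrite NegzE mulrNz mulNr -pmulrn => /ZadjoinN; rewrite opprK.
have abs0 : `|c|%N%:R != 0 :> F by rewrite pnatr_eq0 absz_eq0.
have [||d zd] := @Zadjoin_prim_root_saturated `|c|%N _ _ z_abs.
- by rewrite lt0n absz_eq0.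
- by rewrite mulrC mulKf.
by move=> /(mulfI abs0) ->.
Qed.

End RootOfUnity.

(** * Elements of Q(x) and their integer denominators *)

Section Qadjoin.
Variables (F : numFieldType) (x : F).

Lemma horner_map_ratr (p : {poly rat}) : exists2 c : int, c != 0 &
  exists2 y : F, Zadjoin x y & c%:~R * (map_poly ratr p).[x] = y.
Proof.
have [q [c c0 ->]] := rat_poly_scale p; exists c => //.
exists (map_poly intr q).[x]; first by exists q.
rewrite linearZ /= hornerZ fmorphV /= ratr_int mulrA divff ?mul1r ?intr_eq0 //.
by rewrite -map_poly_comp (eq_map_poly (fun c => ratr_int F c)).
Qed.

(** Take a nonzero integer polynomial vanishing at [y] and strip its factors X, which is possible as
    [y] is nonzero: the constant term is then nonzero and a multiple of [y] in Z[x]. *)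
Lemma Zadjoin_inv (y : F) : integralOver (intr : int -> F) x ->
  Zadjoin x y -> y != 0 ->
  exists2 c : int, c != 0 & Zadjoin x (c%:~R / y).
Proof.
move=> ix zy y0; have [r r_mon] := Zadjoin_integral ix zy.
have := monic_neq0 r_mon; elim/poly_ind: r {r_mon} => [|r c IH]; first by rewrite eqxx.
have [-> | c0] := eqVneq c 0.
  rewrite addr0 mulf_eq0 polyX_eq0 orbF => r0.
  by rewrite rmorphM /= map_polyX rootM rootX (negPf y0) orbF; apply: IH.
move=> _; rewrite rmorphD rmorphM /= map_polyX map_polyC rootE hornerMXaddC.
rewrite addrC addr_eq0 => /eqP /= cE; exists c => //.
by rewrite cE mulNr mulfK //; apply: ZadjoinN; apply: Zadjoin_horner.
Qed.

Lemma Qadjoin_Zadjoin (y : F) : Qadjoin x y -> integralOver (intr : int -> F) x ->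
  exists2 c : int, c != 0 & Zadjoin x (c%:~R * y).
Proof.
move=> [p [q [q0 ->]]] ix.
have [a a0 [u zu uE]] := horner_map_ratr p; have [b b0 [v zv vE]] := horner_map_ratr q.
have v0 : v != 0 by rewrite -vE mulf_neq0 // intr_eq0.
have [c c0 zc] := Zadjoin_inv ix zv v0.
exists (a * c); first by rewrite mulf_neq0.
have -> : (a * c)%:~R * ((map_poly ratr p).[x] / (map_poly ratr q).[x]) =
    u * (b%:~R * (c%:~R / v)) :> F.
  by rewrite -uE -vE intrM; field; rewrite q0 intr_eq0.
by do !apply: ZadjoinM => //; apply: Zadjoin_int.
Qed.

Lemma Zadjoin_sub_ring_of_integers : integralOver (intr : int -> F) x ->
  Zadjoin x `<=` ring_of_integers (Qadjoin x).
Proof.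
move=> ix y zy; split; last exact: Zadjoin_integral zy.
case: zy => p ->; exists (map_poly intr p), 1.
rewrite rmorph1 hornerC oner_neq0 divr1; split=> //.
by rewrite -map_poly_comp (eq_map_poly (fun c => ratr_int F c)).
Qed.

End Qadjoin.

(** * Descent to Z[z + 1/z] by complex conjugation *)

Section RealSubring.
Variables (C : numClosedFieldType) (n : nat) (z : C).
Hypothesis z_prim : n.-primitive_root z.
Let t := z + z^-1.

Let z0 : z != 0.
Proof. by rewrite (prim_root_eq0 z_prim) -lt0n (prim_order_gt0 z_prim). Qed.

Lemma prim_root_conj : z^* = z^-1.
Proof.
have : `|z| == 1.
  by rewrite -(pexpr_eq1 (prim_order_gt0 z_prim)) // -normrX (prim_expr_order z_prim) normr1.
move=> /eqP z1; apply: (mulfI z0).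
by rewrite -normCK z1 expr1n divff.
Qed.

Lemma Qadjoin_conj a : Qadjoin t a -> a^* = a.
Proof.
have tc : t^* = t by rewrite rmorphD fmorphV /= prim_root_conj invrK addrC.
have pc (p : {poly rat}) : ((map_poly ratr p).[t])^* = (map_poly ratr p).[t].
  rewrite -horner_map /= tc -map_poly_comp.
  by rewrite (eq_map_poly (g := ratr)) // => c /=; rewrite fmorph_rat.
by move=> [p [q [_ ->]]]; rewrite rmorphM fmorphV /= !pc.
Qed.

Lemma Zadjoin_prim_root_decomp a : Zadjoin z a ->
  exists b b', [/\ Zadjoin t b, Zadjoin t b' & a = b + b' * z].
Proof.
move=> [p ->]; elim/poly_ind: p => [|p c [b [b' [zb zb' pE]]]].
  by exists 0, 0; split; rewrite ?rmorph0 ?horner0 ?mul0r ?addr0//; apply: Zadjoin0.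
(* The relation [z ^+ 2 = t * z - 1] rewrites [(b + b' * z) * z + c] in this form. *)
exists (c%:~R - b'), (b + b' * t); split.
- by apply: ZadjoinB => //; apply: Zadjoin_int.
- by apply: ZadjoinD => //; apply: ZadjoinM => //; apply: Zadjoin_gen.
rewrite rmorphD rmorphM /= map_polyX map_polyC hornerMXaddC pE /t /=.
by field.
Qed.

Lemma ring_of_integers_real_cyclotomic :
  ring_of_integers (Qadjoin t) = Zadjoin t.
Proof.
have iz := prim_root_integral z_prim.
have ziV : Zadjoin z z^-1.
  have -> : z^-1 = z ^+ n.-1.
    apply: (mulfI z0); rewrite -exprS prednK ?(prim_order_gt0 z_prim) //.
    by rewrite (prim_expr_order z_prim) divff.
  by apply: ZadjoinX; apply: Zadjoin_gen.
have zt : Zadjoin z t by apply: ZadjoinD => //; apply: Zadjoin_gen.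
have it : integralOver (intr : int -> C) t by apply: Zadjoin_integral zt.
apply/seteqP; split; last exact: Zadjoin_sub_ring_of_integers.
move=> a [Qa ia]; have [c c0 tca] := Qadjoin_Zadjoin Qa it.
have zca : Zadjoin z (c%:~R * a) by case: tca => p ->; apply: Zadjoin_horner.
have za := Zadjoin_prim_root_integrally_closed z_prim c0 zca ia.
have [b [b' [tb tb' aE]]] := Zadjoin_prim_root_decomp za.
have conj_t y : Zadjoin t y -> y^* = y.
  by move/(Zadjoin_sub_ring_of_integers it) => [/Qadjoin_conj].
(* [a] equals its conjugate, as do [b] and [b'], while conjugation turns [z] into its inverse. *)
have : b' * z^-1 = b' * z.
  have := Qadjoin_conj Qa; rewrite aE rmorphD rmorphM /= prim_root_conj.
  by rewrite (conj_t b) // (conj_t b') // => /addrI.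
have [b'0 _|b'0 /(mulfI b'0) zE] := eqVneq b' 0.
  by rewrite aE b'0 mul0r addr0.
(* If [b'] is nonzero, [z] is its own inverse, so it is 1 or -1 and lies in Z[t] already. *)
have : z ^+ 2 == 1 by rewrite expr2 -{1}zE mulVf.
rewrite sqrf_eq1 => /orP[] /eqP z1; rewrite aE z1; apply: ZadjoinD => //;
  apply: ZadjoinM => //; first exact: Zadjoin1.
by apply: ZadjoinN; apply: Zadjoin1.
Qed.

End RealSubring.

(** * Closed forms for Dickson polynomials and their link to Chebyshev polynomials *)

Section Dickson.
Variable F : comNzRingType.

Lemma dicksonC_horner (x y : F) k : x * y = 1 ->
  (map_poly intr (dicksonC k)).[x + y] = x ^+ k + y ^+ k.
Proof.
(* Two consecutive indices are proved together, as the recurrence has order two. *)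
move=> xy; suff [] : (map_poly intr (dicksonC k)).[x + y] = x ^+ k + y ^+ k /\
  (map_poly intr (dicksonC k.+1)).[x + y] = x ^+ k.+1 + y ^+ k.+1 by [].
elim: k => [|k [IH0 IH1]].
  by rewrite /= map_polyX hornerX !expr0 !expr1 rmorph_nat /= hornerMn hornerC.
split=> //; rewrite [dicksonC k.+2]/= rmorphB rmorphM /= map_polyX.
rewrite hornerD hornerN hornerM hornerX IH0 -/(dicksonC k.+1) IH1.
rewrite !exprS; ring: xy.
Qed.

(** The closed form is the quotient of [x ^+ k.+1 - y ^+ k.+1] by [x - y]; clearing the denominator
    keeps it meaningful when [x - y] is not invertible. *)
Lemma dicksonS_horner (x y : F) k : x * y = 1 ->
  (map_poly intr (dicksonS k)).[x + y] * (x - y) = x ^+ k.+1 - y ^+ k.+1.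
Proof.
move=> xy; suff [] : (map_poly intr (dicksonS k)).[x + y] * (x - y) = x ^+ k.+1 - y ^+ k.+1 /\
  (map_poly intr (dicksonS k.+1)).[x + y] * (x - y) = x ^+ k.+2 - y ^+ k.+2 by [].
elim: k => [|k [IH0 IH1]].
  rewrite /= map_polyX hornerX !expr1 rmorph1 hornerC mul1r; split=> //.
  by rewrite !expr2; ring.
split=> //; rewrite [dicksonS k.+2]/= rmorphB rmorphM /= map_polyX.
rewrite hornerD hornerN hornerM hornerX mulrBl IH0 -mulrA -/(dicksonS k.+1) IH1.
rewrite !exprS; ring: xy.
Qed.

Lemma chebyshevT_dicksonC (x : F) k :
  2 * (map_poly intr (chebyshevT k)).[x] = (map_poly intr (dicksonC k)).[2 * x].
Proof.
suff [] : 2 * (map_poly intr (chebyshevT k)).[x] = (map_poly intr (dicksonC k)).[2 * x] /\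
  2 * (map_poly intr (chebyshevT k.+1)).[x] = (map_poly intr (dicksonC k.+1)).[2 * x] by [].
elim: k => [|k [IH0 IH1]].
  by rewrite /= !map_polyX !hornerX rmorph_nat rmorph1 /= hornerMn !hornerC mulr1.
split=> //; rewrite [dicksonC k.+2]/= [chebyshevT k.+2]/= !rmorphB !rmorphM /= !linearZ /= !map_polyX.
rewrite !hornerD !hornerN !hornerM hornerZ !hornerX -IH0 -/(dicksonC k.+1) -IH1.
by rewrite /=; ring.
Qed.

Lemma chebyshevU_dicksonS (x : F) k :
  (map_poly intr (chebyshevU k)).[x] = (map_poly intr (dicksonS k)).[2 * x].
Proof.
suff [] : (map_poly intr (chebyshevU k)).[x] = (map_poly intr (dicksonS k)).[2 * x] /\
  (map_poly intr (chebyshevU k.+1)).[x] = (map_poly intr (dicksonS k.+1)).[2 * x] by [].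
elim: k => [|k [IH0 IH1]].
  by rewrite /= linearZ /= !map_polyX hornerZ !hornerX !rmorph1 !hornerC.
split=> //; rewrite [dicksonS k.+2]/= [chebyshevU k.+2]/= !rmorphB !rmorphM /= !linearZ /= !map_polyX.
rewrite !hornerD !hornerN !hornerM hornerZ !hornerX -IH0 -/(dicksonS k.+1) -IH1.
by rewrite /=; ring.
Qed.

End Dickson.

(** * Roots of Dickson polynomials and the fields they generate *)

Lemma Qadjoin_ratr_mul_sub (F : numFieldType) (c : rat) (x : F) :
  Qadjoin (ratr c * x) `<=` Qadjoin x.
Proof.
have compE (p : {poly rat}) :
    (map_poly ratr (p \Po (c *: 'X))).[x] = (map_poly ratr p).[ratr c * x] :> F.
  by rewrite map_comp_poly horner_comp linearZ /= map_polyX hornerZ hornerX.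
by move=> y [p [q]]; rewrite -!compE => ?; exists (p \Po (c *: 'X)), (q \Po (c *: 'X)).
Qed.

Lemma Qadjoin_double (F : numFieldType) (x : F) : Qadjoin (2 * x) = Qadjoin x.
Proof.
apply/seteqP; split.
  by rewrite -(ratr_nat F 2); apply: Qadjoin_ratr_mul_sub.
suff {1}-> : x = ratr (2^-1) * (2 * x) by apply: Qadjoin_ratr_mul_sub.
by rewrite fmorphV /= ratr_nat mulrA mulVf ?mul1r // pnatr_eq0.
Qed.

(** Writing [x] as z + 1/z turns the vanishing of the Dickson polynomial into an equation between
    powers of z and 1/z that makes z a root of unity. *)
Lemma ring_of_integers_dickson_root (C : numClosedFieldType) (k : nat) (x : C) :
  (0 < k)%N ->
  root (map_poly intr (dicksonS k)) x \/ root (map_poly intr (dicksonC k)) x ->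
  ring_of_integers (Qadjoin x) = Zadjoin x.
Proof.
move=> k0 rx.
(* [z] and [y] are the two roots of X^2 - x X + 1, with sum [x] and product 1. *)
pose s := sqrtC (x ^+ 2 - 4); pose z := (x + s) / 2; pose y := (x - s) / 2.
have xE : x = z + y by rewrite /z /y; field.
have zy : z * y = 1.
  have -> : z * y = (x ^+ 2 - s ^+ 2) / 4 by rewrite /z /y; field.
  by rewrite /s sqrtCK; field.
have pow_zy j : z ^+ j * y ^+ j = 1 by rewrite -exprMn zy expr1n.
have [N N0 zN] : exists2 N, (0 < N)%N & z ^+ N = 1.
  case: rx => /rootP; rewrite xE.
    (* Here [z ^+ k.+1 = y ^+ k.+1], and multiplying by [z ^+ k.+1] gives 1 on the right. *)
    move=> Sx; exists (k.+1 * 2)%N => //.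
    have := dicksonS_horner k zy; rewrite Sx mul0r => /esym/eqP.
    by rewrite subr_eq0 exprM expr2 => /eqP {2}->; apply: pow_zy.
  rewrite dicksonC_horner // => /eqP; rewrite addr_eq0 => /eqP Cx.
  (* Here [z ^+ k = - y ^+ k], so [z ^+ (k * 2)] is -1 and its square is 1. *)
  exists (k * 2 * 2)%N; first by rewrite !muln_gt0 k0.
  rewrite exprM [z ^+ (k * 2)]exprM expr2 [z ^+ k ^+ 2]expr2.
  have -> : z ^+ k * z ^+ k = -1 by rewrite {2}Cx mulrN pow_zy.
  by rewrite mulrNN mulr1.
have [n z_prim _] := prim_order_exists N0 zN.
have -> : x = z + z^-1.
  rewrite {1}xE; congr (_ + _); apply: (@mulfI _ z); last first.
    by rewrite zy divff // (prim_root_eq0 z_prim) -lt0n (prim_order_gt0 z_prim).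
  by rewrite (prim_root_eq0 z_prim) -lt0n (prim_order_gt0 z_prim).
exact: ring_of_integers_real_cyclotomic z_prim.
Qed.

Theorem corollary4p2 (R : realType) (n : nat) (n_ge1 : (1 <= n)%N) :
  (forall f : {poly int},
     f \is monic -> irreducible_ZX f ->
     divides_ZX f (dicksonS n) \/ divides_ZX f (dicksonC n) ->
     monogenic R f) /\
  (forall x : R[i],
     root (map_poly intr (chebyshevU n)) x \/
     root (map_poly intr (chebyshevT n)) x ->
     ring_of_integers (Qadjoin x) = Zadjoin (2 * x)).
Proof.
split=> [f f_mon f_irr f_dvd|x rx].
  split=> //.
  (* A constant monic polynomial is 1, a unit; so [f] is not constant and has a complex root. *)
  have [|a fa] := closed_rootP (map_poly (intr : int -> R[i]) f) _.
    have [_ f_nunit _] := f_irr; apply: contraNneq f_nunit.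
    rewrite size_map_poly_id0 ?(monicP f_mon) ?oner_eq0 // => f1.
    have /size_poly1P[c _ fc] : size f == 1%N by rewrite f1.
    by move: f_mon; rewrite fc monicE lead_coefC => /eqP ->; apply: unitr1.
  exists a => //; apply/esym/(ring_of_integers_dickson_root n_ge1).
  by case: f_dvd => -[g ->]; [left|right]; rewrite rmorphM rootM fa.
(* [x] and [2 * x] generate the same field, and [2 * x] is a root of a Dickson polynomial. *)
rewrite -Qadjoin_double; apply: (ring_of_integers_dickson_root n_ge1).
case: rx => /rootP rx; [left|right]; apply/rootP.
  by rewrite -chebyshevU_dicksonS.
by rewrite -chebyshevT_dicksonC rx mulr0.
Qed.
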